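(* Let $S$ be a monoid such that (i) $S$ satisfies $x\,y_1y_2\cdots y_n\,x\,y_ny_{n-1}\cdots y_1\approx x\,y_ny_{n-1}\cdots y_1\,x\,y_1y_2\cdots y_n$ for each $n>1$; (ii) $S$ does not satisfy the identity $xyxy\approx xyyx$; (iii) the words $xytyx$ and $xtyxy$ are isoterms for $S$. Then $S$ is non-finitely based.
   Context: All letters denote distinct variables of a countably infinite alphabet; words are elements of the free semigroup on it. A monoid $S$ satisfies an identity $\mathbf u\approx\mathbf v$ if both sides are equal under every evaluation of the variables in $S$. A word $\mathbf w$ is an isoterm for $S$ if $S$ satisfies no identity $\mathbf w\approx\mathbf w'$ with $\mathbf w'\ne\mathbf w$. $S$ is finitely based if all its identities are derivable from a finite subset of them; otherwise non-finitely based. *)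

(* Defs.v *)
From mathcomp Require Import all_boot.
Set Implicit Arguments. Unset Strict Implicit. Unset Printing Implicit Defensive.

(* Letters are natural numbers (a countably infinite alphabet);
   a word is a sequence of letters.  Words of the free semigroup are the
   nonempty sequences. *)
Definition word := seq nat.

Section Monoid.
Variables (S : Type) (mul : S -> S -> S) (one : S).

Definition eval (phi : nat -> S) (w : word) : S :=
  foldr (fun a acc => mul (phi a) acc) one w.

Definition satisfies (u v : word) : Prop :=
  forall phi : nat -> S, eval phi u = eval phi v.

Definition isoterm (w : word) : Prop :=
  forall w' : word, w' != [::] -> satisfies w w' -> w' = w.
End Monoid.

Definition subst (theta : nat -> word) (w : word) : word :=
  flatten (map theta w).

Definition deriv_step (Sigma : seq (word * word)) (u v : word) : Prop :=
  exists (s t a b : word) (theta : nat -> word),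
    (s, t) \in Sigma /\ (forall x, theta x != [::]) /\
    u = a ++ subst theta s ++ b /\ v = a ++ subst theta t ++ b.

Inductive derivable (Sigma : seq (word * word)) : word -> word -> Prop :=
| der_refl u : derivable Sigma u u
| der_step u v w : derivable Sigma u v ->
    (deriv_step Sigma v w \/ deriv_step Sigma w v) -> derivable Sigma u w.

Definition finitely_based (S : Type) (mul : S -> S -> S) (one : S) : Prop :=
  exists Sigma : seq (word * word),
    (forall p, p \in Sigma ->
       [/\ p.1 != [::], p.2 != [::] & satisfies mul one p.1 p.2]) /\
    (forall u v : word, u != [::] -> v != [::] ->
       satisfies mul one u v -> derivable Sigma u v).

Definition is_monoid (S : Type) (mul : S -> S -> S) (one : S) : Prop :=
  (forall a b c, mul a (mul b c) = mul (mul a b) c) /\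
  (forall a, mul one a = a) /\ (forall a, mul a one = a).

(* Main.v *)
Require Import Defs.
From mathcomp Require Import all_boot zify.
Set Implicit Arguments. Unset Strict Implicit. Unset Printing Implicit Defensive.

(** Write Y for y_1 ... y_n and Y^R for its reversal.  An identity of S with
    both sides shorter than n, applied to a word x Y' x Y'^R, where Y' is a
    permutation of Y starting with y_1, again gives a word of this shape;
    x Y^R x Y is not of this shape, so it cannot be reached from x Y x Y^R.

    Indeed some y_j is not covered by the value of a letter occurring twice on
    the applied side of the identity.  Hence the two occurrences of y_j may be
    replaced by distinct fresh letters p and q, and the identity still applies.
    The resulting words have once-occurring letters between the occurrences of
    the others, so the isoterms xytyx and xtyxy, and their consequences xtxs
    and xytxsy, determine enough of the projections onto few letters of the
    result; the relative order of two y's is controlled by the failure of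
    xyxy = xyyx together with xyyx = yxxy, an instance of (i). *)

(** * Projections of words onto lists of letters *)

Definition proj (L : seq nat) (c : nat) : word :=
  if c \in L then [:: index c L] else [::].

(** Kept letters are renamed to their positions in [L], so that projections can be compared with
    concrete words by computation. Being a substitution, a projection preserves identities of a
    monoid even though it erases letters. *)
Definition restrict (L : seq nat) (w : word) : word := subst (proj L) w.

Lemma subst_cons r c w : subst r (c :: w) = r c ++ subst r w.
Proof. by []. Qed.

Lemma subst_cat r u v : subst r (u ++ v) = subst r u ++ subst r v.
Proof. by rewrite /subst map_cat flatten_cat. Qed.

Lemma eq_in_subst r1 r2 w : {in w, r1 =1 r2} -> subst r1 w = subst r2 w.
Proof. by move=> e; congr flatten; apply/eq_in_map. Qed.

Lemma subst_subst r1 r2 w :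
  subst r1 (subst r2 w) = subst (fun c => subst r1 (r2 c)) w.
Proof. by elim: w => // c w ih; rewrite !subst_cons subst_cat ih. Qed.

Lemma subst_map f w : subst (fun c => [:: f c]) w = map f w.
Proof. exact: flatten_map1. Qed.

Lemma mem_subst r w c l : l \in w -> c \in r l -> c \in subst r w.
Proof. by move=> lw crl; apply/flattenP; exists (r l) => //; apply: map_f. Qed.

Lemma restrict_lt L w c : c \in restrict L w -> c < size L.
Proof.
case/flattenP => u /mapP[d _ ->]; rewrite /proj.
by case: ifP => // dL; rewrite inE => /eqP ->; rewrite index_mem.
Qed.

(** Here [L'] lists positions in [L]. Several projections of a long word thus become projections of
    one short word with letters below [size L], which case analysis can handle. *)
Lemma restrict_comp L L' w : uniq L -> all (ltn^~ (size L)) L' ->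
  restrict L' (restrict L w) = restrict [seq nth 0 L i | i <- L'] w.
Proof.
move=> uL bL'; rewrite /restrict subst_subst; apply: eq_in_subst => c _.
rewrite {2}/proj; case: ifPn => cL; last first.
  rewrite /proj; case: ifP => // /mapP[i iL' ec].
  by case/negP: cL; rewrite ec mem_nth //; apply: (allP bL').
rewrite subst_cons cats0 /proj.
have nE i : i \in L' -> (nth 0 L i == c) = (i == index c L).
  move=> iL'; rewrite -{1}(nth_index 0 cL) nth_uniq ?index_mem //.
  exact: (allP bL').
have -> : (c \in [seq nth 0 L i | i <- L']) = (index c L \in L').
  apply/mapP/idP => [[i iL' /eqP]|iL'].
    by rewrite eq_sym nE // => /eqP <-.
  by exists (index c L) => //; rewrite nth_index.
case: ifP => // _; congr [:: _].
elim: L' bL' nE => //= j L' ih /andP[_ bL'] nE; rewrite nE ?mem_head //.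
by rewrite ih // => i iL'; apply: nE; rewrite inE iL' orbT.
Qed.

Lemma restrict_all L w : all (ltn^~ (size L)) (restrict L w).
Proof. by apply/allP => c; apply: restrict_lt. Qed.

Lemma restrict_cat L u v : restrict L (u ++ v) = restrict L u ++ restrict L v.
Proof. exact: subst_cat. Qed.

Lemma restrict_cons L c w : restrict L (c :: w) = proj L c ++ restrict L w.
Proof. by []. Qed.

Lemma restrictE L w : restrict L w = [seq index c L | c <- w & c \in L].
Proof.
by elim: w => // c w ih; rewrite restrict_cons /proj /= ih; case: ifP.
Qed.

Lemma restrict_rev L w : restrict L (rev w) = rev (restrict L w).
Proof. by rewrite !restrictE filter_rev map_rev. Qed.

Lemma restrict_disjoint L w : {in w, forall c, c \notin L} -> restrict L w = [::].
Proof.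
move=> wL; rewrite restrictE (eq_in_filter (a2 := pred0)) ?filter_pred0 //.
by move=> c /wL /negPf.
Qed.

(** * Gluing two letters into one *)

Definition glue (p q z : nat) (c : nat) : nat :=
  if (c == p) || (c == q) then z else c.

(** In the projection of [W] the letters [p] and [q] get the positions [size L] and [size L + 1];
    [minn] sends both to [size L], the position of [z]. *)
Lemma restrict_glue L p q z W : z \notin W ->
  z \notin L -> p \notin L -> q \notin L -> p != q ->
  restrict (rcons L z) (map (glue p q z) W) =
  [seq minn c (size L) | c <- restrict (rcons (rcons L p) q) W].
Proof.
move=> zW zL pL qL pq; rewrite -!subst_map /restrict !subst_subst.
apply: eq_in_subst => c cW; rewrite /glue subst_cons cats0.
have cz : c != z by apply: contraNneq zW => <-.
rewrite /proj !mem_rcons !inE -!cats1 !index_cat !mem_cat !inE /=.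
have [-> /=|cp] := eqVneq c p.
  by rewrite (negPf zL) (negPf pL) eqxx !orbT /subst /= !addn0 minnn.
have [-> /=|cq] := eqVneq c q.
  rewrite (negPf zL) (negPf qL) !eqxx /subst /= size_cat /=.
  by congr [:: _]; lia.
rewrite /= (negPf cz) orbF /subst; case: (boolP (c \in L)) => cL //=.
congr [:: _]; apply/esym/minn_idPl.
by rewrite ltnW // index_mem.
Qed.

Lemma restrict_glue_notin L p q z W : z \notin L -> p \notin L -> q \notin L ->
  restrict L (map (glue p q z) W) = restrict L W.
Proof.
move=> zL pL qL; rewrite -subst_map /restrict subst_subst.
apply: eq_in_subst => c _; rewrite /glue subst_cons cats0 /proj.
have [->|_] := eqVneq c p; first by rewrite /= (negPf zL) (negPf pL).
by have [->|_] /= := eqVneq c q; rewrite ?(negPf zL) ?(negPf qL).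
Qed.

(** * Splitting words and lifting substitutions *)

Lemma restrict1_cons_split c w i r : restrict [:: c] w = i :: r ->
  exists w1 w2, [/\ w = w1 ++ c :: w2, c \notin w1 & restrict [:: c] w2 = r].
Proof.
elim: w => // d w ih; rewrite /restrict subst_cons {1}/proj inE /=.
case: eqVneq => [-> [_ <-]|dc]; first by exists [::], w.
case/ih => w1 [w2 [-> cw1 <-]]; exists (d :: w1), w2; split => //.
by rewrite inE eq_sym negb_or dc.
Qed.

Lemma restrict1_nil c w : restrict [:: c] w = [::] -> c \notin w.
Proof.
move=> e; apply/negP => cw; suff: 0 \in restrict [:: c] w by rewrite e.
by apply: (mem_subst cw); rewrite /proj !inE eqxx /= eqxx.
Qed.

Lemma split_twice (l : nat) s : 1 < count_mem l s ->
  exists s1 s2 s3, s = s1 ++ l :: s2 ++ l :: s3.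
Proof.
move=> c; have ls : l \in s by rewrite -has_pred1 has_count; lia.
case/splitPr: ls c => s1 s2; rewrite count_cat /= eqxx.
case: (boolP (l \in s1)) => [|/count_memPn -> c].
  by case/splitPr=> s3 s4 _; exists s3, s4, s2; rewrite -catA.
have ls2 : l \in s2 by rewrite -has_pred1 has_count; move: c => /=; lia.
by case/splitPr: ls2 c => s3 s4 _; exists s1, s3, s4.
Qed.

Lemma map_cat_split (f : nat -> nat) W u v : map f W = u ++ v ->
  exists W1 W2, [/\ W = W1 ++ W2, map f W1 = u & map f W2 = v].
Proof.
move=> e; exists (take (size u) W), (drop (size u) W).
by rewrite cat_take_drop map_take map_drop e take_size_cat // drop_size_cat.
Qed.

(* Only letters occurring once in s may need a new value, and for those the
   corresponding factor of W serves. *)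
Lemma lift_subst (f : nat -> nat) theta s W :
  (forall l z, 1 < count_mem l s -> map f z = theta l -> z = theta l) ->
  map f W = subst theta s ->
  exists theta', {in s, forall l, map f (theta' l) = theta l} /\
    subst theta' s = W.
Proof.
move=> inj; elim: s W inj => [|l s ih] W inj.
  move/eqP; rewrite -size_eq0 size_map size_eq0 => /eqP ->.
  by exists (fun=> [::]).
rewrite subst_cons => eW.
set k := size (theta l); rewrite -(cat_take_drop k W) map_cat in eW.
have sz : size (map f (take k W)) = size (theta l).
  rewrite size_map size_take_min; apply/minn_idPl.
  have := congr1 size eW; rewrite -map_cat cat_take_drop size_map size_cat => ->.
  exact: leq_addr.
move/eqP: eW; rewrite eqseq_cat // => /andP[/eqP e1 /eqP e2].
have [|g [gE gs]] := ih (drop k W) _ e2.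
  by move=> l' z cl; apply: inj; rewrite /= (leq_trans cl) ?leq_addl.
case: (boolP (l \in s)) => ls.
  (* A letter that occurs again has only one possible value, so the one chosen by [g] for the tail
     agrees with the first factor of [W]. *)
  have uz z : map f z = theta l -> z = theta l.
    apply: inj; rewrite /= eqxx; move: ls; rewrite -has_pred1 has_count.
    by move=> /=; lia.
  exists g; split=> [c|].
    by rewrite inE => /orP[/eqP ->|]; apply: gE.
  by rewrite subst_cons gs (uz _ (gE l ls)) -(uz _ e1) cat_take_drop.
exists (fun c => if c == l then take k W else g c); split=> [c|].
  by rewrite inE; case: eqP => [-> _|_ /=]; [|exact: gE].
rewrite subst_cons eqxx -[RHS](cat_take_drop k W) -gs; congr (_ ++ _).
by apply: eq_in_subst => c cs; case: eqP cs ls => // -> ->.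
Qed.

(** * Words determined by their projections *)

(* Closes a goal determining a word V over the letters 0..3 by some of its
   projections, by running through the possible letters of V from the left. *)
Ltac decide_word V :=
  rewrite /restrict /subst;
  do 7 (case: V => [|[|[|[|[|?]]]] V] //=).

Lemma restrict_triple w x y z : uniq [:: x; y; z] ->
  restrict [:: x; y] w = [:: 0; 1; 0; 1] ->
  restrict [:: x; z] w = [:: 0; 1; 0; 1] ->
  restrict [:: y; z] w = [:: 0; 1; 1; 0] ->
  restrict [:: x; y; z] w = [:: 0; 1; 2; 0; 2; 1].
Proof.
move=> u; rewrite -(@restrict_comp _ [:: 0; 1] w u) //.
rewrite -(@restrict_comp _ [:: 0; 2] w u) // -(@restrict_comp _ [:: 1; 2] w u) //.
have := restrict_all [:: x; y; z] w; move: (restrict [:: x; y; z] w) => V /=.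
by clear; decide_word V.
Qed.

Lemma restrict_triple_nested w x y z : uniq [:: x; y; z] ->
  restrict [:: x; y] w = [:: 0; 1; 1; 0] ->
  restrict [:: x; z] w = [:: 0; 1; 1; 0] ->
  restrict [:: y; z] w = [:: 0; 1; 1; 0] ->
  restrict [:: x; y; z] w = [:: 0; 1; 2; 2; 1; 0].
Proof.
move=> u; rewrite -(@restrict_comp _ [:: 0; 1] w u) //.
rewrite -(@restrict_comp _ [:: 0; 2] w u) // -(@restrict_comp _ [:: 1; 2] w u) //.
have := restrict_all [:: x; y; z] w; move: (restrict [:: x; y; z] w) => V /=.
by clear; decide_word V.
Qed.

(** * The invariant and the choice of a letter to separate *)

(* The letter 0 is x.  The words satisfying this are exactly the words
   x Y x Y^R with Y a permutation of 1..n starting with 1. *)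
Definition invariant n w :=
  [/\ {in w, forall c, c <= n},
      forall y, 0 < y <= n -> restrict [:: 0; y] w = [:: 0; 1; 0; 1],
      forall y y', 0 < y <= n -> 0 < y' <= n -> y != y' ->
        restrict [:: y; y'] w = [:: 0; 1; 1; 0] \/
        restrict [:: y; y'] w = [:: 1; 0; 0; 1] &
      forall y, 1 < y <= n -> restrict [:: 1; y] w = [:: 0; 1; 1; 0]].

Lemma restrict_iota2 n y y' : 0 < y < y' -> y' <= n ->
  restrict [:: y; y'] (iota 1 n) = [:: 0; 1].
Proof.
move=> y0 yn; rewrite restrictE.
suff -> : [seq c <- iota 1 n | c \in [:: y; y']] = [:: y; y'].
  by rewrite /= !eqxx; case: eqVneq y0 => // ->; rewrite ltnn andbF.
apply: (irr_sorted_eq ltn_trans ltnn).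
- by apply: sorted_filter; [exact: ltn_trans | exact: iota_ltn_sorted].
- by rewrite /= andbT; case/andP: y0.
by move=> c; rewrite mem_filter mem_iota !inE; lia.
Qed.

Lemma restrict_iota1 n y : 0 < y <= n -> restrict [:: 0; y] (iota 1 n) = [:: 1].
Proof.
move=> y0; rewrite restrictE.
suff -> : [seq c <- iota 1 n | c \in [:: 0; y]] = [:: y].
  by case: y y0 => //= y _; rewrite eqxx.
apply: (irr_sorted_eq ltn_trans ltnn) => //.
  by apply: sorted_filter; [exact: ltn_trans | exact: iota_ltn_sorted].
by move=> c; rewrite mem_filter mem_iota !inE; lia.
Qed.

Lemma restrict_swap y y' w : y != y' ->
  restrict [:: y'; y] w = restrict [:: 1; 0] (restrict [:: y; y'] w).
Proof. by move=> yy; rewrite restrict_comp //= inE yy. Qed.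

Lemma invariant_start n :
  invariant n (0 :: iota 1 n ++ 0 :: rev (iota 1 n)).
Proof.
have lt y y' : 0 < y < y' -> y' <= n ->
    restrict [:: y; y'] (0 :: iota 1 n ++ 0 :: rev (iota 1 n)) = [:: 0; 1; 1; 0].
  move=> y0 yn; rewrite restrict_cons restrict_cat restrict_cons restrict_rev.
  rewrite restrict_iota2 // /proj !inE; case: y y0 => // y; case: y' {yn} => //.
split.
- by move=> c; rewrite inE mem_cat inE mem_rev mem_iota; lia.
- move=> y yn; rewrite restrict_cons restrict_cat restrict_cons restrict_rev.
  by rewrite restrict_iota1.
- move=> y y' yn yn' yy; have [ltyy|leyy] := ltnP y y'; [left|right].
    by rewrite lt //; lia.
  by rewrite (@restrict_swap y' y) 1?eq_sym // lt //; lia.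
by move=> y yn; rewrite lt //; lia.
Qed.

(** With the reversed block first, 2 precedes 1, against the last clause of the invariant. *)
Lemma not_invariant_end n : 1 < n ->
  ~ invariant n (0 :: rev (iota 1 n) ++ 0 :: iota 1 n).
Proof.
move=> n1 [_ _ _ /(_ 2)].
rewrite restrict_cons restrict_cat restrict_cons restrict_rev restrict_iota2 //.
by move/(_ n1).
Qed.

(* A letter of s occurring twice carries at most one of the letters 1..n: two of
   them would form a repeated pattern, absent from 0110 and 1001. *)
Lemma ex_sparse_letter n a b s theta :
  invariant n (a ++ subst theta s ++ b) -> size s < n ->
  exists2 z, 0 < z <= n & forall l, 1 < count_mem l s -> z \notin theta l.
Proof.
move=> [_ _ inv _] sn.
pose bad y := [seq l <- s | (1 < count_mem l s) && (y \in theta l)].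
case: (boolP (all (fun y => bad y != [::]) (iota 1 n))); last first.
  case/allPn => z; rewrite mem_iota => zn /negPn/eqP bz.
  exists z; first by lia.
  move=> l cl; apply/negP => zl; suff: l \in bad z by rewrite bz.
  by rewrite mem_filter cl zl /= -has_pred1 has_count; lia.
move/allP => ne; suff : n <= size s by lia.
(* [h y] is a repeated letter of [s] whose value contains [y]; injectivity of [h] on 1..n yields [n]
   distinct letters of [s]. *)
pose h y := head 0 (bad y).
have hb y : y \in iota 1 n -> h y \in bad y.
  by move/ne; rewrite /h; case: (bad y) => // l r _; rewrite mem_head.
rewrite -{1}(size_iota 1 n) -(size_map h); apply: uniq_leq_size; last first.
  by move=> l /mapP[y /hb + ->]; rewrite mem_filter => /andP[].
rewrite map_inj_in_uniq ?iota_uniq // => y y' yn yn' e.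
apply/eqP/negPn/negP => yy.
have := hb _ yn; rewrite mem_filter => /andP[/andP[cl yl] _].
have := hb _ yn'; rewrite mem_filter -e => /andP[/andP[_ yl'] _].
have [s1 [s2 [s3 es]]] := split_twice cl.
set Z := restrict [:: y; y'] (theta (h y)).
have Z0 : 0 \in Z by apply: (mem_subst yl); rewrite /proj !inE eqxx /= eqxx.
have Z1 : 1 \in Z.
  by apply: (mem_subst yl'); rewrite /proj !inE eqxx orbT /= (negPf yy) eqxx.
have Z2 : 1 < size Z.
  by apply: (@uniq_leq_size _ [:: 0; 1]) => // c; rewrite !inE => /orP[]/eqP ->.
(* Two occurrences of [h y] put [Z ++ Z] into a projection of length 4, so [Z] is 01 or 10 and the
   projection would be 0101 or 1010. *)
have sub : subseq (Z ++ Z) (restrict [:: y; y'] (a ++ subst theta s ++ b)).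
  rewrite es !(restrict_cat, subst_cat, subst_cons) -/Z -!catA.
  do 2 (apply: subseq_trans (suffix_subseq _ _)).
  apply: cat_subseq => //; apply: subseq_trans (suffix_subseq _ _).
  exact: prefix_subseq.
move: yn yn'; rewrite !mem_iota => yn yn'.
have := inv y y'; case=> //; try lia; move=> eZ; move: sub Z0 Z1 Z2; rewrite eZ.
all: case: Z => [|c [|d [|? Z]]] // sub Z0 Z1 _.
2,4: by move/size_subseq: sub; rewrite size_cat /=; lia.
all: by move: sub Z0 Z1; rewrite !inE; case: c => [|[|?]]; case: d => [|[|?]].
Qed.

(** The projection onto x and [z] is 0101, so [z] occurs exactly twice; its occurrences become
    [n.+1] and [n.+2], both larger than every letter of [w]. *)
Lemma unglue n w z : invariant n w -> 0 < z <= n ->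
  exists W, [/\ map (glue n.+1 n.+2 z) W = w, z \notin W &
    restrict [:: n.+1; n.+2] W = [:: 0; 1]].
Proof.
move=> [wn w0 _ _] zn.
have : restrict [:: z] w = [:: 0; 0].
  rewrite -(@restrict_comp [:: 0; z] [:: 1]) ?w0 //= andbT inE; lia.
case/restrict1_cons_split => w1 [w2 [ew z1]].
case/restrict1_cons_split => w3 [w4 [ew2 z3 /restrict1_nil z4]].
move: wn; rewrite {}ew {}ew2 => wn; exists (w1 ++ n.+1 :: w3 ++ n.+2 :: w4).
have le v : {subset v <= w1 ++ z :: w3 ++ z :: w4} -> {in v, forall c, c <= n}.
  by move=> sv c /sv /wn.
have {}le : [/\ {in w1, forall c, c <= n}, {in w3, forall c, c <= n} &
               {in w4, forall c, c <= n}].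
  by split; apply: le => c cv; rewrite !(mem_cat, inE) cv ?orbT.
have fix_glue v : {in v, forall c, c <= n} -> map (glue n.+1 n.+2 z) v = v.
  move=> vn; rewrite -[RHS]map_id; apply/eq_in_map => c /vn cn; rewrite /glue.
  by case: ifP => //; lia.
have no v : {in v, forall c, c <= n} -> restrict [:: n.+1; n.+2] v = [::].
  by move=> vn; apply: restrict_disjoint => c /vn; rewrite !inE; lia.
case: le => le1 le3 le4; split.
- rewrite map_cat /= map_cat /= !fix_glue // /glue !eqxx orbT //.
- rewrite !(mem_cat, inE) (negPf z1) (negPf z3) (negPf z4) /=; lia.
rewrite restrict_cat restrict_cons restrict_cat restrict_cons !no //.
have nn : (n.+1 == n.+2) = false by lia.
by rewrite /proj !inE !eqxx orbT /= nn !eqxx.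
Qed.

(** * Identities and isoterms of the monoid *)

Section Identities.
Variables (S : Type) (mul : S -> S -> S) (one : S).
Hypothesis monS : is_monoid mul one.

Local Notation "u ~~ v" := (satisfies mul one u v) (at level 70).
Local Notation ev := (eval mul one).

Lemma eval_cat phi u v : ev phi (u ++ v) = mul (ev phi u) (ev phi v).
Proof.
have [mA [m1 _]] := monS.
by elim: u => [|c u ih] /=; rewrite ?m1 // ih mA.
Qed.

Lemma eval_subst phi r w : ev phi (subst r w) = ev (fun c => ev phi (r c)) w.
Proof. by elim: w => // c w ih; rewrite subst_cons eval_cat ih. Qed.

Lemma satisfies_sym u v : u ~~ v -> v ~~ u.
Proof. by move=> uv phi; rewrite uv. Qed.

Lemma satisfies_trans v u w : u ~~ v -> v ~~ w -> u ~~ w.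
Proof. by move=> uv vw phi; rewrite uv. Qed.

Lemma satisfies_subst r u v : u ~~ v -> subst r u ~~ subst r v.
Proof. by move=> uv phi; rewrite !eval_subst. Qed.

Lemma satisfies_cat a b u v : u ~~ v -> a ++ u ++ b ~~ a ++ v ++ b.
Proof. by move=> uv phi; rewrite !eval_cat uv. Qed.

(* Unlike isoterm, this also excludes w' = [::]. *)
Definition strong_isoterm (w : word) := forall w', w ~~ w' -> w' = w.

(** If the other side is empty, [w] always evaluates to [one], so [w] and [w ++ w] form an identity,
    which the isoterm property forbids. *)
Lemma strong_isotermP w : w != [::] -> isoterm mul one w -> strong_isoterm w.
Proof.
move=> w0 iw [|c w'] ww'; last exact: iw.
have: w ++ w = w.
  apply: iw; first by case: (w) w0.
  by move=> phi; rewrite eval_cat (ww' phi) /=; case: monS => _ [->].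
by case: (w) w0 => // c v _ /(congr1 size); rewrite size_cat /=; lia.
Qed.

Lemma strong_isoterm_factor a w b :
  strong_isoterm (a ++ w ++ b) -> strong_isoterm w.
Proof.
move=> iw w' /(satisfies_cat a b)/iw e.
have/addnI/addIn sz : size a + (size w' + size b) = size a + (size w + size b).
  by rewrite -!size_cat e.
by move/eqP: e; rewrite eqseq_cat // eqxx /= eqseq_cat // => /andP[/eqP].
Qed.

Lemma strong_isoterm_map f w : injective f ->
  strong_isoterm (map f w) -> strong_isoterm w.
Proof.
move=> injf iw w' /(satisfies_subst (fun c => [:: f c])).
by rewrite !subst_map => /iw /(inj_map injf).
Qed.

Hypothesis iso_xytyx : strong_isoterm [:: 0; 1; 2; 1; 0].
Hypothesis iso_xtyxy : strong_isoterm [:: 0; 2; 1; 0; 1].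

(** Otherwise projecting onto [c] gives an identity between the empty word and a nonempty one;
    appending both to xytyx contradicts that it is an isoterm. *)
Lemma satisfies_notin u v c : u ~~ v -> c \notin u -> c \notin v.
Proof.
move=> uv cu; apply/negP => cv.
have := satisfies_subst (proj [:: c]) uv.
have -> : subst (proj [:: c]) u = [::].
  elim: u cu {uv} => // d u ih; rewrite inE negb_or => /andP[dc /ih].
  by rewrite subst_cons /proj inE eq_sym (negPf dc).
move/(satisfies_cat [:: 0; 1; 2; 1; 0] [::])/iso_xytyx => e.
suff: 0 \in subst (proj [:: c]) v by case: (subst _ v) e.
by apply: (mem_subst cv); rewrite /proj !inE eqxx /= eqxx.
Qed.

Lemma iso_xtx : strong_isoterm [:: 0; 1; 0].
Proof.
apply: (@strong_isoterm_map succn) succn_inj _.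
exact: (@strong_isoterm_factor [:: 0] _ [:: 0]).
Qed.

Lemma iso_xt : strong_isoterm [:: 0; 1].
Proof. exact: (@strong_isoterm_factor [::] _ [:: 2; 1; 0]). Qed.

Lemma iso_restrict L u v w : strong_isoterm w -> u ~~ v ->
  restrict L u = w -> restrict L v = w.
Proof. by move=> iw /(satisfies_subst (proj L)) uv e; apply: iw; rewrite -e. Qed.

Lemma satisfies_lt k u v : u ~~ v -> all (ltn^~ k) u -> all (ltn^~ k) v.
Proof.
move=> uv /allP uk; apply/allP => c; apply: contraLR => ck.
by apply: (satisfies_notin uv); apply: contra ck => /uk.
Qed.

(** The projections xtx and ts leave only xtxs and xtsx. The latter projects to the isoterm xsx,
    whereas xtxs projects to xxs. *)
Lemma iso_xtxs : strong_isoterm [:: 0; 1; 0; 2].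
Proof.
move=> V uV.
have bV := satisfies_lt (k := 3) uV isT.
have e1 := iso_restrict (L := [:: 0; 1]) iso_xtx uV erefl.
have e2 := iso_restrict (L := [:: 1; 2]) iso_xt uV erefl.
have e3 : restrict [:: 0; 2] V <> [:: 0; 1; 0].
  by move=> e; have := iso_restrict iso_xtx (satisfies_sym uV) e.
by move: bV e1 e2 e3; clear; decide_word V.
Qed.

(** The projections xtxs, yty and ysy leave only xytxsy and yxtxsy. The latter projects to the
    isoterm yxtxy, whereas xytxsy projects to xytxy. *)
Lemma iso_xytxsy : strong_isoterm [:: 0; 1; 2; 0; 3; 1].
Proof.
move=> V uV.
have bV := satisfies_lt (k := 4) uV isT.
have e1 := iso_restrict (L := [:: 0; 2; 3]) iso_xtxs uV erefl.
have e2 := iso_restrict (L := [:: 1; 2]) iso_xtx uV erefl.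
have e3 := iso_restrict (L := [:: 1; 3]) iso_xtx uV erefl.
have e4 : restrict [:: 1; 0; 2] V <> [:: 0; 1; 2; 1; 0].
  by move=> e; have := iso_restrict iso_xytyx (satisfies_sym uV) e.
by move: bV e1 e2 e3 e4; clear; decide_word V.
Qed.

Hypothesis id2 : [:: 0; 1; 2; 0; 2; 1] ~~ [:: 0; 2; 1; 0; 1; 2].
Hypothesis not_xyxy_xyyx : ~ [:: 0; 1; 0; 1] ~~ [:: 0; 1; 1; 0].

Lemma satisfies_xyyx_yxxy : [:: 0; 1; 1; 0] ~~ [:: 1; 0; 0; 1].
Proof. exact: (satisfies_subst (proj [:: 1; 2]) id2). Qed.

Lemma not_xyyx_xyxy : ~ [:: 0; 1; 1; 0] ~~ [:: 0; 1; 0; 1].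
Proof. by move/satisfies_sym. Qed.

(** Exchanging the letters turns the identity into yxxy = xyxy, and xyyx = yxxy then gives xyyx =
    xyxy. *)
Lemma not_xyyx_yxyx : ~ [:: 0; 1; 1; 0] ~~ [:: 1; 0; 1; 0].
Proof.
move=> e; apply: not_xyyx_xyxy.
apply: satisfies_trans (satisfies_subst (proj [:: 1; 0]) e).
exact: satisfies_xyyx_yxxy.
Qed.

(** * Preservation of the invariant once the occurrences of one letter are separated *)

Section Glue.
Variables (n z : nat) (w W W' : word).
Hypothesis inv_w : invariant n w.
Hypothesis zn : 0 < z <= n.
Hypothesis Ww : map (glue n.+1 n.+2 z) W = w.
Hypothesis zW : z \notin W.
Hypothesis Wpq : restrict [:: n.+1; n.+2] W = [:: 0; 1].
Hypothesis WW' : W ~~ W'.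

Local Notation p := n.+1.
Local Notation q := n.+2.
Local Notation w' := (map (glue p q z) W').

Let zW' : z \notin W'. Proof. exact: satisfies_notin WW' zW. Qed.

Let ww' : w ~~ w'.
Proof. by rewrite -Ww -!subst_map; apply: satisfies_subst. Qed.

(** Separating [z] in xzxz gives xpxq, an instance of the isoterm xtxs. *)
Lemma restrict_fresh_x : restrict [:: 0; p; q] W' = [:: 0; 1; 0; 2].
Proof.
apply: (iso_restrict iso_xtxs WW').
have [_ w0 _ _] := inv_w.
have u : uniq [:: 0; p; q] by rewrite /= !inE; lia.
have := @restrict_glue [:: 0] p q z W zW.
rewrite /= Ww w0 // !inE => /(_ _ isT isT) g.
have {}g := esym (g ltac:(lia) ltac:(lia)).
move: g Wpq; rewrite -(@restrict_comp _ [:: 1; 2] W u) //.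
have := restrict_all [:: 0; p; q] W; move: (restrict [:: 0; p; q] W) => V /=.
by clear; decide_word V.
Qed.

(** Here [w] projects to xyzxzy, hence [W] to xypxqy, an instance of the isoterm xytxsy. *)
Lemma restrict_fresh_outer y : 0 < y <= n -> y != z ->
  restrict [:: y; z] w = [:: 0; 1; 1; 0] ->
  restrict [:: 0; y; p; q] W' = [:: 0; 1; 2; 0; 3; 1].
Proof.
move=> yn yz e; apply: (iso_restrict iso_xytxsy WW').
have [_ w0 _ _] := inv_w.
have u : uniq [:: 0; y; p; q] by rewrite /= !inE; lia.
have := @restrict_glue [:: 0; y] p q z W zW.
rewrite /= Ww restrict_triple ?w0 //; last by rewrite /= !inE; lia.
rewrite !inE => g.
have {}g := esym (g ltac:(lia) ltac:(lia) ltac:(lia) ltac:(lia)).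
move: g Wpq; rewrite -(@restrict_comp _ [:: 2; 3] W u) //.
have := restrict_all [:: 0; y; p; q] W.
move: (restrict [:: 0; y; p; q] W) => V /=.
by clear; decide_word V.
Qed.

(** Here [w] projects to xzyxyz, hence [W] to xpyxyq; without q this is xpyxy, an instance of the
    isoterm xtyxy. *)
Lemma restrict_fresh_inner y : 0 < y <= n -> y != z ->
  restrict [:: y; z] w = [:: 1; 0; 0; 1] ->
  restrict [:: 0; y; p] W' = [:: 0; 2; 1; 0; 1].
Proof.
move=> yn yz e; apply: (iso_restrict iso_xtyxy WW').
have [_ w0 _ _] := inv_w.
have u : uniq [:: 0; y; p; q] by rewrite /= !inE; lia.
have e3 : restrict [:: 0; y; z] w = [:: 0; 2; 1; 0; 1; 2].
  rewrite -(@restrict_comp [:: 0; z; y] [:: 0; 2; 1]) //; last by rewrite /= !inE; lia.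
  have ezy : restrict [:: z; y] w = [:: 0; 1; 1; 0] by rewrite restrict_swap // e.
  have uzy : uniq [:: 0; z; y] by rewrite /= !inE; lia.
  by rewrite (restrict_triple uzy) ?w0.
have := @restrict_glue [:: 0; y] p q z W zW.
rewrite /= Ww e3 !inE => g.
have {}g := esym (g ltac:(lia) ltac:(lia) ltac:(lia) ltac:(lia)).
move: g Wpq; rewrite -(@restrict_comp _ [:: 2; 3] W u) //.
rewrite -(@restrict_comp _ [:: 0; 1; 2] W u) //.
have := restrict_all [:: 0; y; p; q] W.
move: (restrict [:: 0; y; p; q] W) => V /=.
by clear; decide_word V.
Qed.

Lemma restrict_w' y y' : 0 < y <= n -> y != z -> y' <= n -> y' != z ->
  restrict [:: y'; y] w' = restrict [:: y'; y] W'.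
Proof. by move=> *; apply: restrict_glue_notin; rewrite !inE; lia. Qed.

Lemma invariant_glue_xy y : 0 < y <= n -> restrict [:: 0; y] w' = [:: 0; 1; 0; 1].
Proof.
move=> yn; have [_ _ wyy _] := inv_w.
have [-> | yz] := eqVneq y z.
  have := @restrict_glue [:: 0] p q z W' zW'.
  rewrite /= restrict_fresh_x !inE => -> //; lia.
rewrite restrict_w' //; last by lia.
case: (wyy y z) => // e.
  rewrite -(@restrict_comp [:: 0; y; p; q] [:: 0; 1]) ?restrict_fresh_outer //.
  by rewrite /= !inE; lia.
rewrite -(@restrict_comp [:: 0; y; p] [:: 0; 1]) ?restrict_fresh_inner //.
by rewrite /= !inE; lia.
Qed.

(** Since x alternates with each of the two letters, they form two blocks, each in either order. The
    failing identities exclude equal orders. *)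
Lemma invariant_glue_yy y y' : 0 < y <= n -> 0 < y' <= n -> y != y' ->
  restrict [:: y; y'] w' = [:: 0; 1; 1; 0] \/
  restrict [:: y; y'] w' = [:: 1; 0; 0; 1].
Proof.
move=> yn yn' yy; have [_ _ wyy _] := inv_w.
have u : uniq [:: 0; y; y'] by rewrite /= !inE; lia.
have sat := satisfies_subst (proj [:: y; y']) ww'.
have {}sat : [:: 0; 1; 1; 0] ~~ restrict [:: y; y'] w'.
  case: (wyy y y' yn yn' yy) => e; first by rewrite -e.
  by apply: satisfies_trans satisfies_xyyx_yxxy _; rewrite -e.
have n1 : restrict [:: y; y'] w' <> [:: 0; 1; 0; 1].
  by move=> e; apply: not_xyyx_xyxy; rewrite -e.
have n2 : restrict [:: y; y'] w' <> [:: 1; 0; 1; 0].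
  by move=> e; apply: not_xyyx_yxyx; rewrite -e.
have := invariant_glue_xy yn; have := invariant_glue_xy yn'; move: n1 n2.
rewrite -(@restrict_comp _ [:: 1; 2] w' u) //.
rewrite -(@restrict_comp _ [:: 0; 1] w' u) //.
rewrite -(@restrict_comp _ [:: 0; 2] w' u) //.
have := restrict_all [:: 0; y; y'] w'.
move: (restrict [:: 0; y; y'] w') => V /=.
by clear; decide_word V; auto.
Qed.

(** Only 0110 and 1001 are possible, so it suffices that 1 precedes [y]. The argument depends on how
    1 and [y] lie relative to [z]. *)
Lemma invariant_glue_first y : 1 < y <= n ->
  restrict [:: 1; y] w' = [:: 0; 1; 1; 0].
Proof.
move=> yn; have [_ _ wyy w1] := inv_w.
have yn0 : 0 < y <= n by lia.
case: (@invariant_glue_yy 1 y) => // [|| e]; try lia.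
suff: ohead (restrict [:: 1; y] w') = Some 0 by rewrite e.
have W'pq := iso_restrict iso_xt WW' Wpq.
have [z1 | z1] := eqVneq z 1.
  (* Now 1 itself was separated, and xpyxy puts p before [y]. *)
  have yz : y != z by lia.
  have ey : restrict [:: y; z] w = [:: 1; 0; 0; 1].
    by rewrite z1 restrict_swap ?w1 //; lia.
  have := restrict_fresh_inner yn0 yz ey; have := restrict_fresh_x.
  have u : uniq [:: 0; y; p; q] by rewrite /= !inE; lia.
  have u1 : uniq [:: 0; y; z] by rewrite /= !inE; lia.
  have -> : restrict [:: 1; y] w' = restrict [:: 2; 1] (restrict [:: 0; y; z] w').
    by rewrite restrict_comp //= z1.
  have := @restrict_glue [:: 0; y] p q z W' zW'; rewrite /= !inE => -> //; try lia.
  rewrite -(@restrict_comp _ [:: 0; 2; 3] W' u) //.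
  rewrite -(@restrict_comp _ [:: 0; 1; 2] W' u) //.
  have := restrict_all [:: 0; y; p; q] W'.
  move: (restrict [:: 0; y; p; q] W') => V /=.
  by clear; decide_word V.
have [yz | yz] := eqVneq y z.
  (* Now [y] was separated, and x1pxq1 puts 1 before p. *)
  have e1 : restrict [:: 1; z] w = [:: 0; 1; 1; 0] by rewrite -yz w1.
  have := restrict_fresh_outer (y := 1) ltac:(lia) ltac:(lia) e1.
  have u : uniq [:: 0; 1; y] by rewrite /= !inE; lia.
  rewrite -(@restrict_comp _ [:: 1; 2] w' u) //= yz.
  have := @restrict_glue [:: 0; 1] p q z W' zW'; rewrite /= !inE => -> //; try lia.
  by move->.
rewrite restrict_w' //; try lia.
have e1 : restrict [:: 1; z] w = [:: 0; 1; 1; 0] by apply: w1; lia.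
have [ey | ey] := wyy y z ltac:(lia) zn yz.
  (* Both 1 and [y] enclose [z], so [W] projects to 1ypy1, an instance of xytyx. *)
  have u : uniq [:: 1; y; p; q] by rewrite /= !inE; lia.
  have -> // : restrict [:: 1; y] W' = [:: 0; 1; 1; 0].
  rewrite -(@restrict_comp [:: 1; y; p] [:: 0; 1]) //; last first.
    by rewrite /= !inE; lia.
  rewrite (iso_restrict iso_xytyx WW') //.
  have u1 : uniq [:: 1; y; z] by rewrite /= !inE; lia.
  have := @restrict_glue [:: 1; y] p q z W zW.
  rewrite /= Ww (restrict_triple_nested u1) ?e1 ?w1 // !inE => g.
  have {}g := esym (g ltac:(lia) ltac:(lia) ltac:(lia) ltac:(lia)).
  move: g Wpq; rewrite -(@restrict_comp _ [:: 2; 3] W u) //.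
  rewrite -(@restrict_comp _ [:: 0; 1; 2] W u) //.
  have := restrict_all [:: 1; y; p; q] W.
  move: (restrict [:: 1; y; p; q] W) => V /=.
  by clear; decide_word V.
(* Here [z] precedes [y] in [w]; in [W'] the letter 1 comes before p, and p before [y]. *)
have u : uniq [:: 0; 1; y; p] by rewrite /= !inE; lia.
have u4 : uniq [:: 0; 1; p; q] by rewrite /= !inE; lia.
have := restrict_fresh_outer (y := 1) ltac:(lia) ltac:(lia) e1.
move/(congr1 (restrict [:: 0; 1; 2])); rewrite (restrict_comp _ u4) //=.
have := restrict_fresh_inner yn0 yz ey.
rewrite -(@restrict_comp _ [:: 0; 1; 3] W' u) //.
rewrite -(@restrict_comp _ [:: 0; 2; 3] W' u) //.
rewrite -(@restrict_comp _ [:: 1; 2] W' u) //.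
have := restrict_all [:: 0; 1; y; p] W'.
move: (restrict [:: 0; 1; y; p] W') => V /=.
by clear; decide_word V.
Qed.

Lemma invariant_glue : invariant n w'.
Proof.
have [wn _ _ _] := inv_w; split.
- move=> c; apply: contraLR => cn; apply: (satisfies_notin ww').
  by apply: contra cn => /wn.
- exact: invariant_glue_xy.
- exact: invariant_glue_yy.
exact: invariant_glue_first.
Qed.

End Glue.

(** * Preservation of the invariant along derivations *)

Lemma invariant_step n a b s t theta : s ~~ t -> size s < n ->
  invariant n (a ++ subst theta s ++ b) -> invariant n (a ++ subst theta t ++ b).
Proof.
move=> st sn inv_w.
have [z zn sparse] := ex_sparse_letter inv_w sn.
have [W [Ww zW Wpq]] := unglue inv_w zn.
have [Wa [W0 [eW ea /map_cat_split[Ws [Wb [eW0 es eb]]]]]] := map_cat_split Ww.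
(* The value of a repeated letter avoids [z], so its preimage contains neither fresh letter and is
   fixed by [glue]. *)
have [l v cl e|theta' [theta'E e]] := lift_subst _ es.
  rewrite -e -[LHS]map_id; apply/eq_in_map => c cv; rewrite /glue.
  case: ifP => // cpq; case/negP: (sparse l cl); rewrite -e.
  by apply/mapP; exists c; rewrite // /glue cpq.
have := invariant_glue inv_w zn Ww zW Wpq.
move/(_ (Wa ++ subst theta' t ++ Wb)).
have -> : map (glue n.+1 n.+2 z) (Wa ++ subst theta' t ++ Wb) =
    a ++ subst theta t ++ b.
  rewrite !map_cat ea eb -[map _ (subst _ t)]subst_map subst_subst.
  congr (_ ++ (_ ++ _)); apply: eq_in_subst => l lt.
  rewrite [LHS]subst_map theta'E //.
  (* Every letter of [t] occurs in [s], where [theta'] is known to lift [theta]. *)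
  by apply: contraLR lt; apply: satisfies_notin.
apply; rewrite eW eW0 -e; apply: satisfies_cat; exact: satisfies_subst.
Qed.

(** Both sides are bounded because a step may use an identity in either direction. *)
Lemma invariant_derivable n Sigma u v :
  (forall e, e \in Sigma ->
     [/\ e.1 ~~ e.2, size e.1 < n & size e.2 < n]) ->
  derivable Sigma u v -> invariant n u -> invariant n v.
Proof.
move=> sat; elim=> // {}u v0 v1 _ ih step /ih {ih}.
case: step => -[s [t [a [b [theta [/sat[/= st ss ts] [_ [-> ->]]]]]]]].
  exact: invariant_step.
by apply: invariant_step => //; apply: satisfies_sym.
Qed.

End Identities.

Theorem theorem5p1 (S : Type) (mul : S -> S -> S) (one : S) :
  is_monoid mul one ->
  (forall n : nat, 1 < n ->
     satisfies mul one
       (0 :: iota 1 n ++ 0 :: rev (iota 1 n))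
       (0 :: rev (iota 1 n) ++ 0 :: iota 1 n)) ->
  ~ satisfies mul one [:: 0; 1; 0; 1] [:: 0; 1; 1; 0] ->
  isoterm mul one [:: 0; 1; 2; 1; 0] ->
  isoterm mul one [:: 0; 2; 1; 0; 1] ->
  ~ finitely_based mul one.
Proof.
move=> monS ids nid iso1 iso2 [Sigma [sat der]].
have [N bN] : exists N, forall e, e \in Sigma -> size e.1 + size e.2 <= N.
  exists (\max_(e <- Sigma) (size e.1 + size e.2)) => e eS.
  exact: (leq_bigmax_seq e eS).
(* This [n] exceeds the length of each side of every identity in [Sigma], and is greater than 1 even
   if [N] is 0. *)
pose n := N.+2; apply: (@not_invariant_end n) => //.
apply: (invariant_derivable (Sigma := Sigma) monS _ _ (ids 2 isT) nid _ _
                                (invariant_start n)).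
- exact: strong_isotermP.
- exact: strong_isotermP.
- move=> e eS; have [_ _ ?] := sat e eS.
  split=> //; rewrite ltnS leqW //; apply: leq_trans (bN e eS).
    exact: leq_addr.
  exact: leq_addl.
by apply: der => //; exact: ids.
Qed.
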